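(* Suppose $X$ has a maximum $b$ but no minimum. Let $\varphi\in\mathcal{OP}(X)\setminus\mathcal{O}(X)$ with ideal $X_1$, and let $X_2=X\setminus X_1$. Then $\langle \mathcal{O}(X),\varphi\rangle=\mathcal{OP}(X)$ if and only if, for each $i\in\{1,2\}$, there is a set $Y_i\subseteq X_i$ which is order-isomorphic to an open convex subset of $X$ such that $\varphi|_{Y_i}$ is an order-isomorphism (from $Y_i$ onto $Y_i\varphi$), and $\{x\in X : x<y\varphi \text{ for all } y\in Y_2\}=\emptyset$.
   Context: Maps are written on the right of their arguments and composed from left to right. Throughout, $X$ is an infinite linearly ordered set that is dense (for all $x<y$ in $X$ there is $z\in X$ with $x<z<y$). A subset $C\subseteq X$ is convex if $x,y\in C$, $z\in X$ and $x<z<y$ imply $z\in C$; an open convex subset of $X$ is a nonempty convex subset of $X$ having neither a minimum nor a maximum. For sets, $A<B$ means $a<b$ for all $a\in A$, $b\in B$. It is assumed that $X$ satisfies: (a) if $X=X'\cup X''$ with $X'<X''$ and $X',X''\neq\emptyset$, then $X'$ has a maximum or $X''$ has a minimum; (b) any two open convex subsets of $X$ are order-isomorphic. $\mathcal{T}(X)$ is the monoid of all maps $X\to X$ under composition, and $\mathcal{O}(X)$ is its submonoid of order-preserving maps ($x\le y$ implies $x\alpha\le y\alpha$). An order-isomorphism is an order-preserving bijection between subchains; subchains are order-isomorphic if there is an order-isomorphism between them. A map $\alpha\in\mathcal{T}(X)$ is orientation-preserving if there is a nonempty subset $X_1\subseteq X$ such that, with $X_2=X\setminus X_1$: (1) $\alpha$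 is order-preserving on $X_1$ and on $X_2$; and (2) for all $p\in X_1$ and $q\in X_2$, $p<q$ and $p\alpha\ge q\alpha$. Such a set $X_1$ is called an ideal of $\alpha$; it is unique if $\alpha$ is non-constant. $\mathcal{OP}(X)$ is the monoid of all orientation-preserving maps on $X$, and $\mathcal{O}(X)\subseteq\mathcal{OP}(X)$. $\langle\mathcal{O}(X),\varphi\rangle$ denotes the subsemigroup generated by $\mathcal{O}(X)\cup\{\varphi\}$. *)

(* Defs.v *)
From mathcomp Require Export all_boot all_order.
From mathcomp Require Export mathcomp_extra boolp classical_sets functions cardinality.

Set Implicit Arguments.
Unset Strict Implicit.
Unset Printing Implicit Defensive.

Import Order.TTheory.
Local Open Scope order_scope.
Local Open Scope classical_set_scope.

(* Maps act on the right: the product of f and g in T(X) is "f, then g", i.e.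
   [f \; g]. *)

Section Chain.
Context {d : Order.disp_t} {X : orderType d}.
Implicit Types (A B C : set X) (f : X -> X).

Definition has_maximum A := A `&` ubound A !=set0.

Definition has_minimum A := A `&` lbound A !=set0.

Definition set_lt A B := forall a b, A a -> B b -> a < b.

Definition order_dense := forall x y : X, x < y -> exists z, x < z /\ z < y.

Definition convex C := forall x y z, C x -> C y -> x < z -> z < y -> C z.

(* "Open" refers only to the absence of endpoints, not to a topology on X. *)
Definition open_convex C :=
  [/\ C !=set0, convex C, ~ has_minimum C & ~ has_maximum C].

Definition order_preserving_on A f := {in A &, {homo f : x y / x <= y}}.

(* Only the values of f on A matter.  As X is totally ordered, the inverse
   bijection is automatically order-preserving. *)
Definition order_iso A B f := set_bij A B f /\ order_preserving_on A f.

Definition order_isomorphic A B := exists f, order_iso A B f.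

Definition is_ideal f X1 :=
  [/\ X1 !=set0,
      order_preserving_on X1 f,
      order_preserving_on (~` X1) f
    & forall p q, X1 p -> (~` X1) q -> p < q /\ f q <= f p].

End Chain.

Arguments order_dense {d} X.

Definition O_mon {d : Order.disp_t} (X : orderType d) : set (X -> X) :=
  [set f | {homo f : x y / x <= y}].

Definition OP_mon {d : Order.disp_t} (X : orderType d) : set (X -> X) :=
  [set f | exists X1 : set X, is_ideal f X1].

Arguments O_mon {d} X _.
Arguments OP_mon {d} X _.

Definition subsemigroup {T : Type} (S : set (T -> T)) :=
  forall f g, S f -> S g -> S (f \; g).

Definition generated {T : Type} (G : set (T -> T)) : set (T -> T) :=
  smallest subsemigroup G.

(* Main.v *)
Require Import Defs.

Set Implicit Arguments.
Unset Strict Implicit.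
Unset Printing Implicit Defensive.

Import Order.TTheory.
Local Open Scope order_scope.
Local Open Scope classical_set_scope.

(** Necessity.  Since [X] without its maximum and any two of its open intervals
    and rays are isomorphic, there is a bijective rotation [f] of [X] in
    [OP(X)] outside [O(X)] ([rotation_exists]).  Suppose that [f] is a product
    of generators.  Cutting after the first factor [phi] at which the partial
    product leaves [O(X)] gives [f = p \; phi \; r] with [p] in [O(X)] and
    [p \; phi] outside ([generated_prefix]); injectivity of [f] then makes [phi]
    injective on the image under [p] of a ray contained in the preimage of [X1]
    ([order_iso_in_ideal]).  Cutting at the last factor [phi] instead gives
    [f = p \; phi \; r] with [r] in [O(X)] ([generated_suffix]); surjectivity of
    [f] then makes [phi \; r] map [X2] onto a set containing a ray, which
    yields [Y2] together with the coinitiality of its image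
    ([order_iso_in_complement]).

    Sufficiency.  [OP(X)] is closed under composition ([OP_subsemigroup]), so
    only the inclusion of [OP(X)] in the generated semigroup matters.  Each
    [psi] in [OP(X)] outside [O(X)] is in fact a product [p \; phi \; r] with
    [p] and [r] in [O(X)] ([OP_factorization]).  Here [p] embeds the ideal of
    [psi] into [Y1] and its complement into [Y2] ([convex_chain_embedding]), and
    [r] is obtained by extending a partial order-preserving map to all of [X]
    through suprema ([order_preserving_extension]).  Such an extension could
    only be obstructed at points below the domain when the map to be extended
    is unbounded below; this is where coinitiality of the image of [Y2] is
    needed. *)

Section Chain.
Context {d : Order.disp_t} {X : orderType d}.
Implicit Types (A B C D Y : set X) (f g : X -> X).

(** * Order-isomorphisms between subchains *)

Lemma order_preserving_onP A f :
  order_preserving_on A f <->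
  (forall x y, A x -> A y -> x <= y -> f x <= f y).
Proof.
split=> [H x y Ax Ay|H x y]; first by apply: H; rewrite inE.
by rewrite !inE => Ax Ay; exact: H.
Qed.

Lemma image_order_iso A f :
  order_preserving_on A f -> set_inj A f -> order_iso A (f @` A) f.
Proof. by move=> fle finj; split=> //; split=> //; exact: image_subset. Qed.

Lemma order_iso_lt A B f x y :
  order_iso A B f -> A x -> A y -> x < y -> f x < f y.
Proof.
move=> [[_ finj _] /order_preserving_onP fle] Ax Ay xy.
rewrite lt_neqAle fle ?(ltW xy) // andbT; apply/eqP => fxy.
by move: xy; rewrite (finj x y) ?inE // ltxx.
Qed.

Lemma order_iso_sym A B f : order_iso A B f -> order_isomorphic B A.
Proof.
move=> fiso; have [[fAB finj fsurj] _] := fiso.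
have /choice[g gP] y : exists x, B y -> A x /\ f x = y.
  have [/fsurj[x Ax fxy]|nBy] := pselect (B y); first by exists x.
  by exists y.
exists g; split; first split.
- by move=> y /gP[].
- by move=> y z; rewrite !inE => /gP[_ fgy] /gP[_ fgz] gyz; rewrite -fgy gyz.
- by move=> x Ax; have /gP[Agx fgx] := fAB x Ax; exists (f x);
    [exact: fAB | apply: finj; rewrite ?inE].
apply/order_preserving_onP => y z /gP[Ay fgy] /gP[Az fgz] yz.
rewrite leNgt; apply/negP => /(order_iso_lt fiso Az Ay).
by rewrite fgy fgz ltNge yz.
Qed.

(** * Open convex subsets, suprema and extensions *)

Lemma open_convex_below A z :
  order_dense X -> convex A -> ~ has_minimum A -> A z ->
  open_convex (A `&` [set x | x < z]).
Proof.
move=> dense convA nominA Az; split.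
- apply: contrapT => n; apply: nominA; exists z; split=> // x Ax.
  by rewrite leNgt; apply/negP => xz; apply: n; exists x.
- move=> x y t [Ax _] [Ay yz] xt ty; split; first exact: convA xt ty.
  exact: lt_trans ty yz.
- move=> [m [[Am mz] mmin]]; apply: nominA; exists m; split=> // x Ax.
  have [xz|zx] := ltP x z; first exact: mmin.
  exact: le_trans (ltW mz) zx.
- move=> [m [[Am mz] mmax]]; have [t [mt tz]] := dense _ _ mz.
  suff /mmax : (A `&` [set x | x < z]) t by rewrite leNgt mt.
  by split=> //; exact: convA mt tz.
Qed.

Lemma open_convex_lt z :
  order_dense X -> ~ has_minimum [set: X] -> open_convex [set x : X | x < z].
Proof.
by move=> dense nomin; rewrite -[X in open_convex X]setTI; exact: open_convex_below.
Qed.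

Lemma open_convex_between (x y : X) :
  order_dense X -> x < y -> open_convex [set z | x < z /\ z < y].
Proof.
move=> dense xy; split.
- exact: dense.
- move=> u v t [xu _] [_ vy] ut tv.
  by split; [exact: lt_trans ut | exact: lt_trans vy].
- move=> [m [[xm my] mmin]]; have [t [xt tm]] := dense _ _ xm.
  suff : m <= t by rewrite leNgt tm.
  by apply: mmin; split=> //; exact: lt_trans my.
- move=> [m [[xm my] mmax]]; have [t [mt ty]] := dense _ _ my.
  suff : t <= m by rewrite leNgt mt.
  by apply: mmax; split=> //; exact: lt_trans mt.
Qed.

(** The gap condition makes [X] conditionally complete, and [b] bounds every
    subset. *)
Lemma sup_exists (b : X) A :
  (forall X' X'' : set X,
     [set: X] = X' `|` X'' -> set_lt X' X'' -> X' !=set0 -> X'' !=set0 ->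
     has_maximum X' \/ has_minimum X'') ->
  (forall x, x <= b) -> A !=set0 ->
  exists s, ubound A s /\ (forall t, ubound A t -> s <= t).
Proof.
move=> complete b_max [a Aa].
have [allub|/existsNP[c nubc]] := pselect (forall x, ubound A x).
  by exists a; split=> // t; apply.
have [||||[m [nubm maxm]]|[s [ubs mins]]] := complete (~` ubound A) (ubound A).
- by rewrite setUC setUv.
- move=> x y nubx uby; rewrite ltNge; apply/negP => yx; apply: nubx => z Az.
  exact: le_trans (uby _ Az) yx.
- by exists c.
- by exists b.
- move: nubm => /existsNP[x /not_implyP[Ax /negP]]; rewrite -ltNge => mx.
  exists x; split=> [|t]; last exact.
  apply: contrapT => /maxm; rewrite leNgt => /negP; exact.
- by exists s.
Qed.


(** A correspondence [u x |-> v x] that is well defined and order-preserving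
    extends to an order-preserving map on [X], provided that every point has an
    element of the range of [u] below it or that [v] is bounded below. *)
Lemma order_preserving_extension (b : X) (u v : X -> X) :
  (forall X' X'' : set X,
     [set: X] = X' `|` X'' -> set_lt X' X'' -> X' !=set0 -> X'' !=set0 ->
     has_maximum X' \/ has_minimum X'') ->
  (forall x, x <= b) ->
  (forall x y, u x <= u y -> v x <= v y) ->
  (forall z, (exists x, u x <= z) \/ (exists w, forall x, w <= v x)) ->
  exists f, O_mon X f /\ forall x, f (u x) = v x.
Proof.
move=> complete b_max uv below.
(* The value at z is the supremum of the v x with u x <= z; the lower bounds of
   v are added to keep the set nonempty when there is no such x. *)
pose S z := [set w | (exists2 x, u x <= z & w = v x) \/ (forall x, w <= v x)].
have S0 z : S z !=set0.
  by have [[x uxz]|[w wv]] := below z; [exists (v x); left; exists x|exists w; right].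
have /choice[f fP] z := sup_exists complete b_max (S0 z).
exists f; split=> [y z yz|x].
  apply: (fP y).2 => w Sw; apply: (fP z).1.
  case: Sw => [[x uxy ->]|wv]; [left; exists x => //|by right].
  exact: le_trans uxy yz.
apply/le_anti/andP; split.
  by apply: (fP (u x)).2 => w [[y uyx ->]|]; [exact: uv|exact].
by apply: (fP (u x)).1; left; exists x.
Qed.

(** [D] with the maximum [b] of [X] added embeds into every [Y] isomorphic to an
    open convex set, with the image of [D] coinitial in [Y]: for [e] in [C],
    send [b] to [e] and [D] isomorphically onto the part of [C] below [e]. *)
Lemma convex_chain_embedding (b : X) C D Y :
  order_dense X ->
  (forall A B, open_convex A -> open_convex B -> order_isomorphic A B) ->
  (forall x, x <= b) ->
  open_convex C -> order_isomorphic Y C -> open_convex D ->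
  exists h : X -> X,
  [/\ forall x y, D x \/ x = b -> D y \/ y = b -> x < y -> h x < h y,
      forall x, D x \/ x = b -> Y (h x)
    & forall y, Y y -> exists2 x, D x & h x <= y].
Proof.
move=> dense homog b_max [[e Ce] convC nominC nomaxC] [k /order_iso_sym[g giso]] oD.
have oC' := open_convex_below dense convC nominC Ce.
have [f fiso] := homog _ _ oD oC'.
have [D0 _ _ nomaxD] := oD.
have nDb : ~ D b by move=> Db; apply: nomaxD; exists b; split=> // x _.
have [[fDC _ fsurj] _] := fiso.
have [[gCY _ gsurj] /order_preserving_onP gle] := giso.
have fD x : D x -> x == b = false by move=> Dx; apply/eqP => xb; apply: nDb; rewrite -xb.
pose h x := if x == b then e else f x.
have hC x : D x \/ x = b -> C (h x).
  case=> [Dx|->]; rewrite /h ?eqxx // fD //.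
  by have [] := fDC x Dx.
exists (g \o h); split.
- move=> x y Px Py xy; apply: (order_iso_lt giso); [exact: hC|exact: hC|].
  case: Px => [Dx|xb]; last by move: xy; rewrite xb ltNge b_max.
  rewrite /h fD //; case: Py => [Dy|->].
    by rewrite fD //; exact: (order_iso_lt fiso).
  by rewrite eqxx; have [] := fDC x Dx.
- by move=> x /hC /gCY.
- move=> y /gsurj[c Cc <-].
  suff [x Dx hxc] : exists2 x, D x & h x <= c.
    by exists x => //; apply: gle => //; apply: hC; left.
  have [ce|ec] := ltP c e.
    have [|x Dx fxc] := fsurj c; first by split.
    by exists x => //; rewrite /h fD // fxc.
  have [x Dx] := D0; exists x => //; rewrite /h fD //.
  by have [_ /ltW fxe] := fDC x Dx; exact: le_trans ec.
Qed.

(** * Orientation-preserving maps *)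

Lemma ideal_downset f A x y : is_ideal f A -> A x -> y <= x -> A y.
Proof.
move=> [_ _ _ cross] Ax yx; apply: contrapT => nAy.
by have [] := cross x y Ax nAy; rewrite ltNge yx.
Qed.

(** The lower part of the cut may be empty: [f] is then order-preserving, with
    ideal [X]. *)
Lemma OP_of_cut f A :
  (forall x y, A x -> A y -> x <= y -> f x <= f y) ->
  (forall x y, ~ A x -> ~ A y -> x <= y -> f x <= f y) ->
  (forall p q, A p -> ~ A q -> p < q /\ f q <= f p) ->
  [set: X] !=set0 -> OP_mon X f.
Proof.
move=> fA fnA cross [x0 _].
have [A0|nA0] := pselect (A !=set0).
  by exists A; split=> //; apply/order_preserving_onP.
have nA x : ~ A x by move=> Ax; apply: nA0; exists x.
exists setT; split.
- by exists x0.
- by apply/order_preserving_onP => x y _ _; exact: fnA.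
- by apply/order_preserving_onP => x y /(_ I).
- by move=> p q _ /(_ I).
Qed.

Lemma O_sub_OP f : [set: X] !=set0 -> O_mon X f -> OP_mon X f.
Proof.
by move=> X0 fO; apply: (@OP_of_cut _ setT) => [x y _ _|x y []|p q _ []|] //; exact: fO.
Qed.

(** Let [F] and [G] be the ideals of [f] and [g].  If some point of [F] is sent
    into [G], then [F] intersected with the preimage of [G] is an ideal of the
    product; otherwise the union of [F] and the preimage of [G] is the lower
    part of a suitable cut. *)
Lemma OP_subsemigroup : subsemigroup (OP_mon X).
Proof.
move=> f g [F fF] [G gG].
have dF := fun x y => @ideal_downset f F x y fF.
have dG := fun x y => @ideal_downset g G x y gG.
have [[x0 _] /order_preserving_onP f1 /order_preserving_onP f2 fx] := fF.
have [_ /order_preserving_onP g1 /order_preserving_onP g2 gx] := gG.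
have X0 : [set: X] !=set0 by exists x0.
have [[a [Fa Gfa]]|n] := pselect (exists a, F a /\ G (f a)).
  (* Values outside F are at most f a, hence in G. *)
  have E x : ~ F x -> G (f x) by move=> /(fx _ _ Fa)[_]; exact: dG.
  apply: (@OP_of_cut _ (fun x => F x /\ G (f x))) => //.
  - by move=> x y [Fx Gx] [Fy Gy] xy /=; apply: g1 => //; exact: f1.
  - move=> x y nx ny xy /=.
    have [Fx|nFx] := pselect (F x); have [Fy|nFy] := pselect (F y).
    + have nGx : ~ G (f x) by move=> ?; apply: nx.
      have nGy : ~ G (f y) by move=> ?; apply: ny.
      by apply: g2 => //; exact: f1.
    + have nGx : ~ G (f x) by move=> ?; apply: nx.
      by have [] := gx _ _ (E _ nFy) nGx.
    + by case: nFx; exact: dF xy.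
    + by apply: g1; [exact: E|exact: E|exact: f2].
  - move=> p q [Fp Gp] nq /=; have [Fq|nFq] := pselect (F q).
      have nGq : ~ G (f q) by move=> ?; apply: nq.
      have [fpq gqp] := gx _ _ Gp nGq; split=> //.
      by rewrite ltNge; apply/negP => qp; move: fpq; rewrite ltNge f1.
    have [pq fqp] := fx _ _ Fp nFq; split=> //.
    by apply: g1 => //; exact: E.
have nG x : F x -> ~ G (f x) by move=> Fx Gx; apply: n; exists x.
apply: (@OP_of_cut _ (fun x => F x \/ G (f x))) => //.
- move=> x y Px Py xy /=.
  have [Fx|nFx] := pselect (F x); have [Fy|nFy] := pselect (F y).
  + by apply: g2; [exact: nG|exact: nG|exact: f1].
  + by case: Py => // Gy; have [] := gx _ _ Gy (nG _ Fx).
  + by case: nFx; exact: dF xy.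
  + by case: Px Py => // ? [] // ?; apply: g1 => //; exact: f2.
- move=> x y /not_orP[nFx nGx] /not_orP[nFy nGy] xy /=.
  by apply: g2 => //; exact: f2.
- move=> p q Pp /not_orP[nFq nGq] /=; have [Fp|nFp] := pselect (F p).
    have [pq fqp] := fx _ _ Fp nFq; split=> //.
    by apply: g2 => //; exact: nG.
  case: Pp => // Gp; have [fpq gqp] := gx _ _ Gp nGq; split=> //.
  by rewrite ltNge; apply/negP => qp; move: fpq; rewrite ltNge f2.
Qed.

(** * Factorizations of products of generators *)

Lemma generated_prefix phi f :
  generated (O_mon X `|` [set phi]) f -> ~ O_mon X f ->
  exists p r, [/\ O_mon X p, ~ O_mon X (p \; phi) & f = p \; phi \; r].
Proof.
(* The statement about p \; f for all p in O(X) is what is closed under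
   composition. *)
pose P (f : X -> X) := forall p, O_mon X p -> O_mon X (p \; f) \/
  exists q r, [/\ O_mon X q, ~ O_mon X (q \; phi) & p \; f = q \; phi \; r].
move=> genf nOf; suff /(_ id) : P f by move=> [|//|[q [r qrP]]] //; exists q, r.
apply: genf; split=> [g h Pg Ph p Op|g [Og|->] p Op].
- have [/Ph//|[q [r [Oq nOq e]]]] := Pg p Op.
  right; exists q, (r \; h); split=> //.
  by rewrite [RHS](_ : _ = (q \; phi \; r) \; h) // -e.
- by left=> x y xy /=; apply: Og; exact: Op.
- by have [|nO] := pselect (O_mon X (p \; phi)); [left|right; exists p, id].
Qed.

Lemma generated_suffix phi f :
  generated (O_mon X `|` [set phi]) f -> ~ O_mon X f ->
  exists p r, O_mon X r /\ f = p \; phi \; r.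
Proof.
pose P (f : X -> X) := O_mon X f \/ exists p r, O_mon X r /\ f = p \; phi \; r.
move=> genf nOf; suff [//|//] : P f.
apply: genf; split=> [g h Pg|g [Og|->]].
- move=> [Oh|[p [r [Or ->]]]]; last by right; exists (g \; p), r.
  case: Pg => [Og|[p [r [Or ->]]]]; first by left=> x y xy /=; apply: Oh; exact: Og.
  by right; exists p, (r \; h); split=> // x y xy /=; apply: Oh; exact: Or.
- by left.
- by right; exists id, id; split.
Qed.

(** * The rotation and the necessity of the condition *)

Lemma notO_complement f A : is_ideal f A -> ~ O_mon X f -> (~` A) !=set0.
Proof.
move=> [_ /order_preserving_onP fA _ _] nOf; apply: contrapT => nA0; apply: nOf.
have allA x : A x by apply: contrapT => nAx; apply: nA0; exists x.
by move=> x y; exact: fA.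
Qed.

(** Fix [c < b].  The rotation sends [x < c] into [c < y < b] and [c < x < b]
    into [y < c] by order-isomorphisms, sends [c] to [b] and [b] to [c]. *)
Lemma rotation_exists (b : X) :
  order_dense X ->
  (forall A B, open_convex A -> open_convex B -> order_isomorphic A B) ->
  (forall x, x <= b) -> ~ has_minimum [set: X] ->
  exists f : X -> X,
  [/\ OP_mon X f, ~ O_mon X f, injective f & forall y, exists x, f x = y].
Proof.
move=> dense homog b_max nomin.
have [c cb] : exists c, c < b.
  apply: contrapT => n; apply: nomin; exists b; split=> // x _.
  by rewrite leNgt; apply/negP => xb; apply: n; exists x.
have oL := open_convex_lt c dense nomin.
have oR := open_convex_between dense cb.
have [g giso] := homog _ _ oL oR.
have [h hiso] := homog _ _ oR oL.
have [[gLR _ gsurj] _] := giso; have [[hRL _ hsurj] _] := hiso.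
pose f x :=
  if x < c then g x else if x == c then b else if x == b then c else h x.
have fL x : x < c -> f x = g x by rewrite /f => ->.
have fc : f c = b by rewrite /f ltxx eqxx.
have fb : f b = c by rewrite /f ltNge b_max /= gt_eqF // eqxx.
have fR x : c < x -> x < b -> f x = h x.
  by move=> cx xb; rewrite /f ltNge (ltW cx) /= gt_eqF // lt_eqF.
have monoL x y : x <= c -> y <= c -> x < y -> f x < f y.
  move=> xc yc xy; have {}xc := lt_le_trans xy yc.
  move: yc; rewrite le_eqVlt => /orP[/eqP->|yc].
    by rewrite fc fL //; have [] := gLR x xc.
  by rewrite !fL //; exact: (order_iso_lt giso).
have monoR x y : c < x -> c < y -> x < y -> f x < f y.
  move=> cx cy xy; have xb := lt_le_trans xy (b_max y).
  have := b_max y; rewrite le_eqVlt => /orP[/eqP->|yb].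
    by rewrite fb fR //; apply: hRL.
  by rewrite !fR //; exact: (order_iso_lt hiso).
have fgtc x : x <= c -> c < f x.
  rewrite le_eqVlt => /orP[/eqP->|xc]; first by rewrite fc.
  by rewrite fL //; have [] := gLR x xc.
have flec x : c < x -> f x <= c.
  move=> cx; have := b_max x; rewrite le_eqVlt => /orP[/eqP->|xb].
    by rewrite fb.
  by rewrite fR //; apply/ltW; apply: hRL.
have fneq x y : x < y -> f x <> f y.
  move=> xy fxy; have [yc|cy] := leP y c.
    by have := monoL _ _ (ltW (lt_le_trans xy yc)) yc xy; rewrite fxy ltxx.
  have [xc|cx] := leP x c; first by have := fgtc _ xc; rewrite fxy ltNge flec.
  by have := monoR _ _ cx cy xy; rewrite fxy ltxx.
exists f; split.
- apply: (@OP_of_cut _ [set x | x <= c]) => /=; last by exists b.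
  + move=> x y xc yc; rewrite le_eqVlt => /orP[/eqP->//|xy].
    by apply/ltW; exact: monoL.
  + move=> x y /negP; rewrite -ltNge => cx /negP; rewrite -ltNge => cy.
    by rewrite le_eqVlt => /orP[/eqP->//|xy]; apply/ltW; exact: monoR.
  + move=> p q pc /negP; rewrite -ltNge => cq; split; first exact: le_lt_trans cq.
    by apply: le_trans (flec _ cq) _; apply/ltW; exact: fgtc.
- by move=> /(_ c b (ltW cb)); rewrite fc fb leNgt cb.
- by move=> x y fxy; case: (ltgtP x y) => // /fneq; rewrite fxy.
- move=> y; have [yc|cy|->] := ltgtP y c; last by exists b.
    by have [x [cx xb] <-] := hsurj y yc; exists x; rewrite fR.
  have := b_max y; rewrite le_eqVlt => /orP[/eqP->|yb]; first by exists c.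
  by have [|x xc <-] := gsurj y; [split|exists x; rewrite fL].
Qed.

(** If an injective map factors as [p \; phi \; r] with [p] order-preserving and
    [p \; phi] not, then some [p z] lies in the ideal of [phi], hence [p] maps
    the whole ray [x < z] into it, and [phi] is injective on the image. *)
Lemma order_iso_in_ideal phi X1 p r (f : X -> X) :
  order_dense X -> ~ has_minimum [set: X] -> is_ideal phi X1 ->
  O_mon X p -> ~ O_mon X (p \; phi) -> injective f -> f = p \; phi \; r ->
  exists Y1, [/\ Y1 `<=` X1,
    exists C, open_convex C /\ order_isomorphic Y1 C &
    order_iso Y1 (phi @` Y1) phi].
Proof.
move=> dense nomin idX Op nOpphi finj fE.
have [_ le1 /order_preserving_onP le2 _] := idX.
have inj_prefix x y : phi (p x) = phi (p y) -> x = y.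
  by move=> e; apply: finj; rewrite fE /= e.
have [z X1z] : exists z, X1 (p z).
  apply: contrapT => n; apply: nOpphi => x y xy /=.
  by apply: le2; [| |exact: Op] => X1p; apply: n; [exists x|exists y].
have oC := open_convex_lt z dense nomin.
have sub : p @` [set x | x < z] `<=` X1.
  by move=> _ [x xz <-]; apply: (ideal_downset idX X1z); exact/Op/ltW.
exists (p @` [set x | x < z]); split=> //.
  exists [set x | x < z]; split=> //.
  apply: (@order_iso_sym _ _ p); apply: image_order_iso.
    by apply/order_preserving_onP => x y _ _; exact: Op.
  by move=> x y _ _ e; apply: inj_prefix; rewrite e.
apply: image_order_iso.
  move/order_preserving_onP in le1.
  by apply/order_preserving_onP => x y /sub X1x /sub X1y; exact: le1.
by move=> x y; rewrite !inE => -[u _ <-] [v _ <-] /inj_prefix ->.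
Qed.

(** If a surjective map factors as [p \; phi \; r] with [r] order-preserving,
    then [phi \; r] maps the complement of the ideal of [phi] onto a set
    containing a ray [z < e]; a section over this ray is the required set.  Its
    image under [phi] is coinitial, as a strict lower bound would be sent by
    [r] to a minimum of [X]. *)
Lemma order_iso_in_complement phi X1 p r (f : X -> X) :
  order_dense X -> ~ has_minimum [set: X] -> is_ideal phi X1 ->
  (~` X1) !=set0 ->
  O_mon X r -> (forall y, exists x, f x = y) -> f = p \; phi \; r ->
  exists Y2, [/\ Y2 `<=` ~` X1,
    exists C, open_convex C /\ order_isomorphic Y2 C,
    order_iso Y2 (phi @` Y2) phi &
    [set x | forall y, Y2 y -> x < phi y] = set0].
Proof.
move=> dense nomin idX [q nX1q] Or fsurj fE.
have [_ _ /order_preserving_onP le2 cross] := idX.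
pose e := r (phi q).
have /choice[s sP] z : exists y, z < e -> ~ X1 y /\ r (phi y) = z.
  have [x fxz] := fsurj z; exists (p x) => ze.
  move: fxz; rewrite fE /= => rz; split=> // X1p.
  have [_ /Or] := cross _ _ X1p nX1q.
  by rewrite rz leNgt ze.
have oC := open_convex_lt e dense nomin.
pose Y2 := s @` [set z | z < e].
have sub : Y2 `<=` ~` X1 by move=> _ [z /sP[? _] <-].
have inj y y' : Y2 y -> Y2 y' -> r (phi y) = r (phi y') -> y = y'.
  by move=> [z ze <-] [z' ze' <-]; rewrite (sP z ze).2 (sP z' ze').2 => ->.
have Y2le : order_preserving_on Y2 phi.
  by apply/order_preserving_onP => x y /sub nx /sub ny; exact: le2.
exists Y2; split=> //.
- exists [set z | z < e]; split=> //; exists (r \o phi); split; first split.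
  + by move=> _ [z ze <-] /=; rewrite (sP z ze).2.
  + by move=> x y; rewrite !inE; exact: inj.
  + by move=> z ze; exists (s z); [exists z|rewrite /= (sP z ze).2].
  + move/order_preserving_onP in Y2le.
    by apply/order_preserving_onP => x y Y2x Y2y xy; apply: Or; exact: Y2le.
- apply: image_order_iso => // x y; rewrite !inE => Y2x Y2y xy.
  by apply: inj; rewrite // xy.
- apply/seteqP; split=> // x /= xlt; apply: nomin; exists (r x); split=> // w _.
  have le_rx z : z < e -> r x <= z.
    by move=> ze; rewrite -(sP z ze).2; apply/Or/ltW/xlt; exists z.
  have [[z0 z0e] _ _ _] := oC.
  have [we|ew] := ltP w e; first exact: le_rx.
  exact: le_trans (le_rx _ z0e) (le_trans (ltW z0e) ew).
Qed.

(** * The sufficiency of the condition *)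

(** When [psi] is unbounded below, the complement of its ideal has no minimum:
    its value there would bound [psi] from below.  Density lets the maximum [b]
    be removed without creating a new one. *)
Lemma complement_open_convex (b : X) psi W :
  order_dense X -> (forall x, x <= b) -> is_ideal psi W -> (~` W) !=set0 ->
  ~ (exists w, forall x, w <= psi x) ->
  open_convex (~` W `&` [set x | x < b]).
Proof.
move=> dense b_max idW [q nWq] nolow.
have [_ _ /order_preserving_onP le2 cross] := idW.
have up x y : ~ W x -> x <= y -> ~ W y.
  by move=> nWx xy Wy; apply: nWx; exact: ideal_downset idW Wy xy.
have nWb : ~ W b by apply: (up q) => //.
have nomin m : ~ W m -> exists2 x, ~ W x & x < m.
  move=> nWm; apply: contrapT => n; apply: nolow; exists (psi m) => x.
  have [Wx|nWx] := pselect (W x); first by have [] := cross _ _ Wx nWm.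
  apply: le2 => //; rewrite leNgt; apply/negP => xm.
  by apply: n; exists x.
split.
- by have [x nWx xb] := nomin b nWb; exists x.
- move=> x y z [nWx _] [_ yb] xz zy; split; first exact: up (ltW xz).
  exact: lt_trans yb.
- move=> [m [[nWm mb] mmin]]; have [x nWx xm] := nomin m nWm.
  suff : m <= x by rewrite leNgt xm.
  by apply: mmin; split=> //; exact: lt_trans mb.
- move=> [m [[nWm mb] mmax]]; have [x [mx xb]] := dense _ _ mb.
  suff : x <= m by rewrite leNgt mx.
  by apply: mmax; split=> //; exact: up (ltW mx).
Qed.

(** [p] embeds the ideal of [psi] into [Y1] and its complement into [Y2].  Then
    [p \; phi] is injective and rotates the two pieces as [psi] does, so that
    [psi] is order-preserving in terms of [p \; phi], and [r] is an
    order-preserving extension of this correspondence.  When [psi] is unbounded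
    below, the extension exists because the embedding into [Y2] can be chosen
    coinitial. *)
Lemma OP_factorization (b : X) phi psi X1 W Y1 Y2 C1 C2 :
  order_dense X ->
  (forall X' X'' : set X,
     [set: X] = X' `|` X'' -> set_lt X' X'' -> X' !=set0 -> X'' !=set0 ->
     has_maximum X' \/ has_minimum X'') ->
  (forall A B, open_convex A -> open_convex B -> order_isomorphic A B) ->
  (forall x, x <= b) -> ~ has_minimum [set: X] ->
  is_ideal phi X1 -> is_ideal psi W -> (~` W) !=set0 ->
  Y1 `<=` X1 -> Y2 `<=` ~` X1 ->
  open_convex C1 -> order_isomorphic Y1 C1 ->
  open_convex C2 -> order_isomorphic Y2 C2 ->
  order_iso Y1 (phi @` Y1) phi -> order_iso Y2 (phi @` Y2) phi ->
  [set x | forall y, Y2 y -> x < phi y] = set0 ->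
  exists p r, [/\ O_mon X p, O_mon X r & psi = p \; phi \; r].
Proof.
move=> dense complete homog b_max nomin idX idW W20 YX1 YX2.
move=> oC1 Y1C oC2 Y2C iso1 iso2 coin.
have [_ /order_preserving_onP psi1 /order_preserving_onP psi2 psix] := idW.
have [_ _ _ phix] := idX.
have Db x : x < b \/ x = b.
  by have := b_max x; rewrite le_eqVlt => /orP[/eqP|]; [right|left].
have oX := open_convex_lt b dense nomin.
have [h1 [h1lt h1Y _]] :=
  convex_chain_embedding dense homog b_max oC1 Y1C oX.
have {}h1lt x y : x < y -> h1 x < h1 y by apply: h1lt; exact: Db.
have {}h1Y x : Y1 (h1 x) by apply: h1Y; exact: Db.
have [h2 [h2lt h2Y h2low]] : exists h2 : X -> X,
    [/\ forall x y, ~ W x -> ~ W y -> x < y -> h2 x < h2 y,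
        forall x, ~ W x -> Y2 (h2 x)
      & (exists w, forall x, w <= psi x) \/
        forall y, Y2 y -> exists x, ~ W x /\ h2 x <= y].
  have [low|nolow] := pselect (exists w, forall x, w <= psi x).
    have [h2 [h2lt h2Y _]] :=
      convex_chain_embedding dense homog b_max oC2 Y2C oX.
    exists h2; split=> [x y _ _|x _|]; last by left.
    - by apply: h2lt; exact: Db.
    - by apply: h2Y; exact: Db.
  have oW := complement_open_convex dense b_max idW W20 nolow.
  have [h2 [h2lt h2Y h2low]] :=
    convex_chain_embedding dense homog b_max oC2 Y2C oW.
  have WD x : ~ W x -> (~` W `&` [set x | x < b]) x \/ x = b.
    by move=> nWx; case: (Db x); [left|right].
  exists h2; split=> [x y /WD Dx /WD Dy|x /WD Dx|].
  - exact: h2lt.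
  - exact: h2Y.
  right.
  by move=> y /h2low[x [nWx _] h2x]; exists x.
pose p x := if x \in W then h1 x else h2 x.
have pW x : W x -> p x = h1 x by move=> Wx; rewrite /p mem_set.
have pnW x : ~ W x -> p x = h2 x by move=> nWx; rewrite /p memNset.
have plt x y : x < y -> p x < p y.
  move=> xy; have [Wx|nWx] := pselect (W x); have [Wy|nWy] := pselect (W y).
  - by rewrite !pW //; exact: h1lt.
  - rewrite pW // pnW //.
    by have [] := phix _ _ (YX1 _ (h1Y x)) (YX2 _ (h2Y _ nWy)).
  - by case: nWx; exact: (ideal_downset idW Wy (ltW xy)).
  - by rewrite !pnW //; exact: h2lt.
(* Y1 has no minimum, so phi cannot glue a point of Y2 to a point of Y1. *)
have cross_lt x y : Y1 x -> Y2 y -> phi y < phi x.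
  move=> Y1x Y2y.
  have [k kiso] := Y1C; have [[kYC _ ksurj] _] := kiso.
  have [_ _ nominC _] := oC1.
  have [x' Y1x' xx'] : exists2 x', Y1 x' & x' < x.
    apply: contrapT => n; apply: nominC; exists (k x); split; first exact: kYC.
    move=> _ /ksurj[x' Y1x' <-]; have [_ /order_preserving_onP kle] := kiso.
    by apply: kle => //; rewrite leNgt; apply/negP => x'x; apply: n; exists x'.
  have [_ le] := phix _ _ (YX1 _ Y1x') (YX2 _ Y2y).
  exact: le_lt_trans le (order_iso_lt iso1 Y1x' Y1x xx').
have phip_lt1 x y : W x -> W y -> x < y -> phi (p x) < phi (p y).
  by move=> Wx Wy xy; rewrite !pW //; apply: (order_iso_lt iso1) => //; exact: h1lt.
have phip_lt2 x y : ~ W x -> ~ W y -> x < y -> phi (p x) < phi (p y).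
  move=> nWx nWy xy; rewrite !pnW //.
  by apply: (order_iso_lt iso2); [exact: h2Y|exact: h2Y|exact: h2lt].
have [||r [Or rE]] :=
  @order_preserving_extension b (p \; phi) psi complete b_max.
- move=> x y /= phixy.
  have [Wx|nWx] := pselect (W x); have [Wy|nWy] := pselect (W y).
  + apply: psi1 => //; rewrite leNgt; apply/negP => yx.
    by move: phixy; rewrite leNgt phip_lt1.
  + by move: phixy; rewrite leNgt (pW _ Wx) (pnW _ nWy) cross_lt //; exact: h2Y.
  + by have [] := psix _ _ Wy nWx.
  + apply: psi2 => //; rewrite leNgt; apply/negP => yx.
    by move: phixy; rewrite leNgt phip_lt2.
- move=> z; case: h2low => [|h2low]; [by right|left].
  have /existsNP[y /not_implyP[Y2y /negP]] : ~ (forall y, Y2 y -> z < phi y).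
    by move=> zlt; have : set0 z by rewrite -coin.
  rewrite -leNgt => yz; have [x [nWx h2x]] := h2low y Y2y.
  exists x => /=; rewrite pnW //; apply: le_trans yz.
  have [_ /order_preserving_onP phi2] := iso2.
  by apply: phi2 => //; exact: h2Y.
exists p, r; split=> //.
  by move=> x y; rewrite le_eqVlt => /orP[/eqP->//|/plt/ltW].
by apply/funext => x; rewrite -rE.
Qed.

End Chain.

(** * Generation of the monoid of orientation-preserving maps *)

Theorem proposition8 (d : Order.disp_t) (X : orderType d)
  (X_infinite : infinite_set [set: X])
  (X_dense : order_dense X)
  (X_complete : forall X' X'' : set X,
     [set: X] = X' `|` X'' -> set_lt X' X'' -> X' !=set0 -> X'' !=set0 ->
     has_maximum X' \/ has_minimum X'')
  (X_homogeneous : forall C D : set X,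
     open_convex C -> open_convex D -> order_isomorphic C D)
  (b : X) (b_max : forall x : X, x <= b)
  (X_nomin : ~ has_minimum [set: X])
  (phi : X -> X) (phi_OP : (OP_mon X `\` O_mon X) phi)
  (X1 X2 : set X) (X1_ideal : is_ideal phi X1) (X2_def : X2 = [set: X] `\` X1) :
  generated (O_mon X `|` [set phi]) = OP_mon X <->
  exists Y1 Y2 : set X,
    [/\ Y1 `<=` X1 /\ Y2 `<=` X2,
        exists C : set X, open_convex C /\ order_isomorphic Y1 C,
        exists C : set X, open_convex C /\ order_isomorphic Y2 C,
        order_iso Y1 (phi @` Y1) phi /\ order_iso Y2 (phi @` Y2) phi
      & [set x | forall y, Y2 y -> x < phi y] = set0].
Proof.
have X0 : [set: X] !=set0 by exists b.
have [phiOP phi_notO] := phi_OP.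
have {}X2_def : X2 = ~` X1 by rewrite X2_def setTD.
have X2_nonempty := notO_complement X1_ideal phi_notO.
rewrite X2_def; split=> [genE|[Y1 [Y2 [[YX1 YX2] [C1 [oC1 Y1C]] [C2 [oC2 Y2C]]
    [iso1 iso2] coin]]]].
  have [f [fOP fnotO finj fsurj]] :=
    rotation_exists X_dense X_homogeneous b_max X_nomin.
  rewrite -genE in fOP.
  have [p [r [Op nOp fE]]] := generated_prefix fOP fnotO.
  have [Y1 [YX1 Y1C iso1]] :=
    order_iso_in_ideal X_dense X_nomin X1_ideal Op nOp finj fE.
  have [p' [r' [Or' fE']]] := generated_suffix fOP fnotO.
  have [Y2 [YX2 Y2C iso2 coin]] := order_iso_in_complement X_dense X_nomin
    X1_ideal X2_nonempty Or' fsurj fE'.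
  by exists Y1, Y2; split.
apply/seteqP; split.
  apply: smallest_sub; first exact: OP_subsemigroup.
  by move=> f [Of|-> //]; exact: O_sub_OP.
move=> psi [W idW] S [Ssub SG].
have [Opsi|nOpsi] := pselect (O_mon X psi); first by apply: SG; left.
have [p [r [Op Or ->]]] := OP_factorization X_dense X_complete X_homogeneous
  b_max X_nomin X1_ideal idW (notO_complement idW nOpsi) YX1 YX2 oC1 Y1C
  oC2 Y2C iso1 iso2 coin.
have Sp : S p by apply: SG; left.
have Sr : S r by apply: SG; left.
have Sphi : S phi by apply: SG; right.
exact: Ssub (Ssub _ _ Sp Sphi) Sr.
Qed.
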